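(* Let $X$ and $Y$ be metric spaces. Assume that $X$ is separable, that all the closed subsets of $X$ are Baire spaces, and that $A\subseteq Y^X$. The following conditions are equivalent: (1) $A$ is equi-Baire class one. (2) For each $\varepsilon>0$ there exists a sequence $(G^\varepsilon_m)_{m\in\omega}$ of closed subsets of $X$, whose union is $X$, such that for each $f\in A$ and each integer $m$, $\mathrm{diam}(f[G^\varepsilon_m])<\varepsilon$. (3) There exists a metrizable separable topology on $X$, finer than the original topology, all of whose open sets are $F_\sigma$ subsets of $X$ for the original topology, making $A$ equicontinuous. (4) Every nonempty closed subset $F$ of $X$ contains a point $x$ such that $\{f_{|F} : f\in A\}$ is equicontinuous at $x$.
   Context: $\mathcal{B}_1(X,\mathbb{R}^*_+)$ is the set of Baire class one functions $X\to(0,\infty)$, i.e. those for which preimages of open sets are $F_\sigma$. $A\subseteq Y^X$ is equi-Baire class one if for each $\varepsilon>0$ there exists $\delta(\varepsilon)\in\mathcal{B}_1(X,\mathbb{R}^*_+)$ such that for all $x,x'\in X$: $d_X(x,x')<\min(\delta(\varepsilon)(x),\delta(\varepsilon)(x'))$ implies $d_Y(f(x),f(x'))<\varepsilon$ for all $f\in A$. *)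

(* Defs.v *)
From HB Require Import structures.
From mathcomp Require Import all_boot all_order all_algebra.
From mathcomp Require Import all_classical all_reals all_analysis.
From mathcomp Require Import borel_hierarchy.

Set Implicit Arguments.
Unset Strict Implicit.
Unset Printing Implicit Defensive.

Import Order.TTheory GRing.Theory Num.Theory.
Import numFieldNormedType.Exports.

Local Open Scope classical_set_scope.
Local Open Scope ring_scope.

Definition separable (T : topologicalType) : Prop :=
  exists2 D : set T, countable D & dense D.

Definition baire_space (T : topologicalType) : Prop :=
  forall U : (set T)^nat,
    (forall i, open (U i) /\ dense (U i)) -> dense (\bigcap_i U i).

(* The metric is a full metric structure on the carrier of T, whose own
   topology is required to coincide with the given one. *)
Definition metrizable (R : realType) (T : topologicalType) : Prop :=
  exists m : Metric R T, @open (Metric.Pack m) = @open T.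

Definition baire_class_one (S T : topologicalType) (f : S -> T) : Prop :=
  forall U : set T, open U -> Fsigma (f @^-1` U).

(* The half-line as a subset, so that (via the coercion from sets to types) it
   carries the subspace topology of R. *)
Definition pos_reals (R : realType) : set R := [set r | 0 < r].
Arguments pos_reals R : clear implicits.

Definition equi_baire_class_one (R : realType) (X Y : metricType R)
    (A : set (X -> Y)) : Prop :=
  forall e : R, 0 < e -> exists2 delta : X -> pos_reals R,
    baire_class_one delta &
    forall x x' : X,
      mdist x x' < Num.min (set_val (delta x)) (set_val (delta x')) ->
      forall f, A f -> mdist (f x) (f x') < e.

(* Extended-real valued, as S may be unbounded; 0 is added to the set of
   distances so that the diameter of the empty set is 0 (ereal_sup set0 is
   -oo). *)
Definition diam (R : realType) (Y : metricType R) (S : set Y) : \bar R :=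
  ereal_sup (0%E |` [set (mdist u v)%:E | u in S & v in S]).

(* The library's [equicontinuous] requires a pointed codomain, which would
   exclude the empty metric space. *)
Definition equicontinuous_at (R : realType) (T : topologicalType)
    (Y : metricType R) (W : set (T -> Y)) (x : T) : Prop :=
  forall e : R, 0 < e ->
    \forall y \near x, forall f, W f -> mdist (f x) (f y) < e.

(* Main.v *)
(** (1) => (2): cut the F_sigma sets {delta > 1/n} into pieces of diameter less
    than 1/n.
    (2) => (3): if (F_n) enumerates the covers for e = 1/k, the metric
    d(x,y) + 1/(n+1), with n the least index such that F_n separates x and y,
    makes every F_n clopen, and has a countable basis of sets that are F_sigma
    for d.
    (3) => (4): the trace on F of a countable basis of the fine topology
    consists of F_sigma sets; by Baire, some point of F is interior in F to
    every basic set that contains it, so at this point the identity of F into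
    the fine topology is continuous.
    (4) => (1): there is a largest open set with a countable cover by closed
    sets of small oscillation, and a point of equicontinuity of its complement
    would enlarge it, so it is X.  Given such a cover (G_m) of X, let delta(x)
    be at most the distance from x to the union of the G_i, i < m, for some m
    with x in G_m: two points that are delta-close get the same m. *)
Require Import Defs.
From HB Require Import structures.
From mathcomp Require Import all_boot all_order all_algebra.
From mathcomp Require Import all_classical all_reals all_analysis.
From mathcomp Require Import borel_hierarchy.

Set Implicit Arguments.
Unset Strict Implicit.
Unset Printing Implicit Defensive.

Import Order.TTheory GRing.Theory Num.Theory.
Import numFieldNormedType.Exports.

Local Open Scope classical_set_scope.
Local Open Scope ring_scope.

(** * Countable unions and closure properties of F_sigma sets *)

Lemma bigcup_unpickle (C : countType) (T : Type) (F : C -> set T) :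
  \bigcup_n (if unpickle n is Some c then F c else set0) = \bigcup_c F c.
Proof.
apply/seteqP; split=> x [n _].
  by case: (unpickle n) => // c Fx; exists c.
by move=> Fx; exists (pickle n) => //; rewrite pickleK.
Qed.

Section Fsigma_closure.
Context {T : topologicalType}.
Implicit Types (A B : set T).

Lemma Fsigma_bigcup (C : countType) (F : C -> set T) :
  (forall c, Fsigma (F c)) -> Fsigma (\bigcup_c F c).
Proof.
move=> FF.
have /choice[K KP] : forall c, exists K : (set T)^nat,
    (forall i, closed (K i)) /\ F c = \bigcup_i K i.
  by move=> c; have [K ? ?] := FF c; exists K.
pose L (p : C * nat) := K p.1 p.2.
exists (fun n => if unpickle n is Some p then L p else set0).
  move=> n; case: (unpickle n) => [[c i]|]; last exact: closed0.
  exact: (KP c).1.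
rewrite bigcup_unpickle; apply/seteqP; split=> x.
  by move=> [c _]; rewrite (KP c).2 => -[i _ Kx]; exists (c, i).
by move=> [[c i] _ Kx]; exists c => //; rewrite (KP c).2; exists i.
Qed.

Lemma Fsigma_bigcup_cond (C : countType) (D : set C) (F : C -> set T) :
  (forall c, D c -> Fsigma (F c)) -> Fsigma (\bigcup_(c in D) F c).
Proof.
move=> FF; rewrite bigcup_mkcond; apply: Fsigma_bigcup => c.
case: ifPn => [|_]; first by rewrite inE; exact: FF.
exact/closed_Fsigma/closed0.
Qed.

Lemma FsigmaI A B : Fsigma A -> Fsigma B -> Fsigma (A `&` B).
Proof.
move=> [K cK ->] [L cL ->].
have -> : \bigcup_i K i `&` \bigcup_i L i =
          \bigcup_(p : nat * nat) (K p.1 `&` L p.2).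
  apply/seteqP; split=> x.
    by move=> [[i _ Kx] [j _ Lx]]; exists (i, j).
  by move=> [[i j] _ /= [Kx Lx]]; split; [exists i|exists j].
by apply: Fsigma_bigcup => p; apply: closed_Fsigma; exact: closedI.
Qed.

End Fsigma_closure.

Lemma Fsigma_preimage (S T : topologicalType) (f : S -> T) (B : set T) :
  continuous f -> Fsigma B -> Fsigma (f @^-1` B).
Proof.
move=> cf [K cK ->]; exists (fun i => f @^-1` K i).
  by move=> i; apply: closed_comp => // x _; exact: cf.
by rewrite preimage_bigcup.
Qed.

(** * Baire category *)

(** For closed [K], the interior of [K] together with the complement of [K] is open and dense. A
    point common to all these sets that lies in [B n] lies in a closed piece of [B n], hence in the
    interior of that piece. *)
Lemma baire_Fsigma_nbhs (T : topologicalType) (B : (set T)^nat) :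
  baire_space T -> [set: T] !=set0 -> (forall n, Fsigma (B n)) ->
  exists x, forall n, B n x -> nbhs x (B n).
Proof.
move=> baireT T0 FB.
have /choice[K KP] : forall n, exists K : (set T)^nat,
    (forall i, closed (K i)) /\ B n = \bigcup_i K i.
  by move=> n; have [K ? ?] := FB n; exists K.
pose U (p : nat * nat) := ((K p.1 p.2)° `|` ~` K p.1 p.2 : set T).
pose V n := if unpickle n is Some p then U p else setT.
have VP n : open (V n) /\ dense (V n).
  rewrite /V; case: (unpickle n) => [p|]; last first.
    by split; [exact: openT|move=> O O0 _; rewrite setIT].
  split.
    by apply: openU; [exact: open_interior|exact/closed_openC/(KP _).1].
  move=> O [x Ox] oO.
  have [OK|/existsNP[y /not_implyP[Oy Ky]]] := pselect (O `<=` K p.1 p.2).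
    exists x; split=> //; left; rewrite /interior.
    by apply: (filterS OK); exact: open_nbhs_nbhs.
  by exists y; split=> //; right.
have [x [_ Vx]] := baireT V VP setT T0 openT.
exists x => n; rewrite (KP n).2 => -[i _ Kx].
have := Vx (pickle (n, i)) I; rewrite /V pickleK /U /= => -[|//].
by apply: filterS => y Ky; exists i.
Qed.

(** * Neighbourhoods and F_sigma sets in a metric space *)

Section metric.
Context {R : realType} {X : metricType R}.
Implicit Types (E U : set X) (x y : X).

Lemma nbhs_mdistP x U :
  nbhs x U <-> exists2 r : R, 0 < r & forall y, mdist x y < r -> U y.
Proof.
split.
  move=> /nbhs_ballP[r r0 sU]; exists r => // y xy.
  by apply: sU; rewrite ballEmdist.
move=> [r r0 sU]; apply/nbhs_ballP; exists r => // y.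
by rewrite ballEmdist; exact: sU.
Qed.

Lemma open_mdist_lt x (r : R) : open [set y | mdist x y < r].
Proof.
rewrite openE => y /= xy; apply/nbhs_mdistP.
exists (r - mdist x y); first by rewrite subr_gt0.
move=> z yz /=; rewrite (le_lt_trans (metric_triangle x y z))//.
by rewrite -ltrBrDl.
Qed.

(** Distance at least [r] from [E], stated without an infimum; for empty [E] it is the whole
    space. *)
Definition far E (r : R) := [set x | forall y, E y -> r <= mdist y x].

Lemma closed_far E r : closed (far E r).
Proof.
have -> : far E r = \bigcap_(y in E) ~` [set x | mdist y x < r].
  apply/seteqP; split=> x fx y Ey; first by apply/negP; rewrite -leNgt fx.
  by rewrite leNgt; apply/negP; exact: fx.
by apply: closed_bigI => y _; exact/open_closedC/open_mdist_lt.
Qed.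

Lemma bigcup_far E : closed E -> \bigcup_k far E k.+1%:R^-1 = ~` E.
Proof.
move=> cE; apply/seteqP; split=> x.
  by move=> [k _ fx] /fx; rewrite mdistxx leNgt invr_gt0 ltr0n.
move=> Ex; have /nbhs_mdistP[r r0 rE] : nbhs x (~` E).
  by apply: open_nbhs_nbhs; split => //; exact: closed_openC.
have [k kr] := ltr_add_invr (y := 0) (x := r) r0.
exists k => // y Ey; rewrite leNgt; apply/negP => yx.
apply: (rE y _ Ey); rewrite metric_sym (lt_trans yx)//.
by rewrite add0r in kr.
Qed.

Lemma open_Fsigma U : open U -> Fsigma U.
Proof.
move=> oU; rewrite -[U]setCK -bigcup_far; last exact: open_closedC.
by apply: Fsigma_bigcup => k; exact/closed_Fsigma/closed_far.
Qed.

Lemma closedD_Fsigma E E' : closed E -> closed E' -> Fsigma (E `\` E').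
Proof.
move=> cE cE'; apply: FsigmaI; first exact: closed_Fsigma.
exact/open_Fsigma/closed_openC.
Qed.

End metric.

(** * Networks and separability *)

(* Like a countable base, except that the members need not be open. *)
Definition network (T : topologicalType) (B : (set T)^nat) :=
  forall (U : set T) x, open U -> U x -> exists n, B n x /\ B n `<=` U.

Lemma network_bigcup (T : topologicalType) (B : (set T)^nat) (U : set T) :
  network B -> open U -> U = \bigcup_(n in [set n | B n `<=` U]) B n.
Proof.
move=> nB oU; apply/seteqP; split=> x; last by move=> [n + Bx]; exact.
by move=> Ux; have [n [Bx BU]] := nB _ _ oU Ux; exists n.
Qed.

Lemma network_separable (T : topologicalType) (B : (set T)^nat) :
  network B -> separable T.
Proof.
move=> nB.
have /choice[D DP] : forall n, exists D : set T,
    [/\ countable D, D `<=` B n & B n !=set0 -> D !=set0].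
  move=> n; have [[x Bx]|B0] := pselect (B n !=set0).
    by exists [set x]; split=> [|y ->|_]//; exists x.
  by exists set0; split=> [||/B0]//.
exists (\bigcup_n D n).
  by apply: bigcup_countable => [|n _]; [exact: countableP|case: (DP n)].
move=> U [x Ux] oU; have [n [Bx BU]] := nB _ _ oU Ux.
have [_ DB D0] := DP n.
have [|y Dy] := D0; first by exists x.
by exists y; split; [exact/BU/DB|exists n].
Qed.

Lemma separable_network (R : realType) (X : metricType R) :
  separable X -> exists2 B : (set X)^nat, network B & forall n, open (B n).
Proof.
move=> [D /countable_injP[f] injf dD].
(* As [f] is injective on [D], this union is a single ball or empty. Writing it as a union avoids a
   default centre, which an empty space could not supply. *)
pose b (p : nat * nat) :=
  \bigcup_(z in [set z | D z /\ f z = p.1]) [set y | mdist z y < p.2.+1%:R^-1].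
exists (fun n => if unpickle n is Some p then b p else set0); last first.
  move=> n; case: (unpickle n) => [p|]; last exact: open0.
  by apply: bigcup_open => z _; exact: open_mdist_lt.
move=> U x oU Ux.
have /nbhs_mdistP[r r0 rU] : nbhs x U by exact: open_nbhs_nbhs.
have [k] := ltr_add_invr (y := 0) (x := r / 2) (divr_gt0 r0 (ltr0Sn _ 1)).
rewrite add0r => kr.
have [|z [/= xz Dz]] := dD [set y | mdist x y < k.+1%:R^-1] _ (open_mdist_lt _ _).
  by exists x; rewrite /= mdistxx invr_gt0 ltr0n.
exists (pickle (f z, k)); rewrite pickleK; split.
  by exists z => //=; rewrite metric_sym.
move=> y [z' [/= Dz' fz'] zy].
have zz' : z' = z by apply: injf; rewrite ?inE.
rewrite zz' in zy; apply: rU.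
by rewrite (le_lt_trans (metric_triangle x z y))// [r]splitr ltrD// (lt_trans _ kr).
Qed.

(** * The refined metric *)

Section first_difference.
Context {R : realType} {T : Type} (F : (set T)^nat).
Implicit Types x y z : T.

Definition differ x y n := `[< F n x >] != `[< F n y >].

(** Pullback of the usual ultrametric on the Cantor space along the map sending a point to its
    sequence of memberships in the [F n]. It is only a pseudometric. *)
Definition code_dist x y : R :=
  if pselect (exists n, differ x y n) is left e then (ex_minn e).+1%:R^-1
  else 0.

Lemma code_dist_ge x y n : differ x y n -> n.+1%:R^-1 <= code_dist x y.
Proof.
move=> xyn; rewrite /code_dist; case: pselect => [e|[]]; last by exists n.
case: ex_minnP => m _ /(_ _ xyn) mn.
by rewrite lef_pV2 ?posrE ?ltr0n// ler_nat ltnS.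
Qed.

Lemma code_distP x y :
  code_dist x y = 0 \/ exists2 n, differ x y n & code_dist x y = n.+1%:R^-1.
Proof.
rewrite /code_dist; case: pselect => [e|_]; last by left.
by right; case: ex_minnP => m xym _; exists m.
Qed.

Lemma code_dist_ge0 x y : 0 <= code_dist x y.
Proof. by case: (code_distP x y) => [->//|[n _ ->]]; rewrite invr_ge0. Qed.

Lemma code_distxx x : code_dist x x = 0.
Proof. by case: (code_distP x x) => // -[n]; rewrite /differ eqxx. Qed.

Lemma code_dist_sym x y : code_dist x y = code_dist y x.
Proof.
rewrite /code_dist.
have -> : differ x y = differ y x.
  by apply/funext => n; rewrite /differ eq_sym.
by [].
Qed.

(** The first index that separates [x] from [z] separates [y] from one of them, so one summand alone
    is large enough. *)
Lemma code_dist_triangle y x z :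
  code_dist x z <= code_dist x y + code_dist y z.
Proof.
case: (code_distP x z) => [->|[n xzn ->]].
  by rewrite addr_ge0// code_dist_ge0.
have [/eqP xyn|xyn] := boolP (`[< F n x >] == `[< F n y >]).
  rewrite (le_trans (@code_dist_ge y z n _)) ?lerDr ?code_dist_ge0//.
  by rewrite /differ -xyn.
by rewrite (le_trans (@code_dist_ge x y n _)) ?lerDl ?code_dist_ge0.
Qed.

End first_difference.

(* X with the topology in which the sets F n become clopen. *)
Definition refined {R : realType} {X : metricType R} (F : (set X)^nat) : Type :=
  X.

Section refined_metric.
Context {R : realType} {X : metricType R} (F : (set X)^nat).

Let dist (x y : X) : R := mdist x y + code_dist F x y.

Let distxx x : dist x x = 0.
Proof. by rewrite /dist mdistxx code_distxx addr0. Qed.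

Let mdist_le_dist x y : mdist x y <= dist x y.
Proof. by rewrite lerDl code_dist_ge0. Qed.

Let dist_positivity x y : dist x y = 0 -> x = y.
Proof.
move=> xy0; apply: mdist_positivity; apply/eqP.
by rewrite eq_le mdist_ge0 andbT -xy0.
Qed.

Let dist_sym x y : dist x y = dist y x.
Proof. by rewrite /dist metric_sym code_dist_sym. Qed.

Let dist_triangle y x z : dist x z <= dist x y + dist y z.
Proof. by rewrite addrACA lerD ?metric_triangle ?code_dist_triangle. Qed.

HB.instance Definition _ := Choice.on (refined F).
HB.instance Definition _ := isMetric.Build R (refined F)
  distxx dist_positivity dist_sym dist_triangle.

Lemma refined_mdistE (x y : refined F) :
  mdist x y = mdist (x : X) (y : X) + code_dist F x y.
Proof. by []. Qed.

Lemma refined_finer (U : set X) : @open X U -> @open (refined F) U.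
Proof.
rewrite !openE => oU x /oU /nbhs_mdistP[r r0 rU]; apply/nbhs_mdistP.
by exists r => // y xy; apply: rU; exact: le_lt_trans (mdist_le_dist _ _) xy.
Qed.

Lemma refined_open n : @open (refined F) (F n).
Proof.
rewrite openE => x Fx; apply/nbhs_mdistP; exists n.+1%:R^-1.
  by rewrite invr_gt0 ltr0n.
move=> y; rewrite refined_mdistE => xy; apply: contrapT => Fy; move: xy.
apply/negP; rewrite -leNgt.
rewrite (le_trans (@code_dist_ge R _ F x y n _)) ?lerDr ?mdist_ge0//.
by rewrite /differ (asboolT Fx) (asboolF Fy).
Qed.

Let cell (s : seq bool) : set X :=
  [set y | forall i, (i < size s)%N -> `[< F i y >] = nth false s i].

Let Fsigma_cell s : (forall n, closed (F n)) -> Fsigma (cell s).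
Proof.
move=> cF.
(* The induction is on the number of constraints with [s] fixed; [k = size s] gives the cell. *)
suff : forall k, Fsigma
    [set y | forall i, (i < k)%N -> `[< F i y >] = nth false s i] by apply.
elim=> [|k IH].
  rewrite (_ : [set _ | _] = setT); last exact/seteqP.
  exact/closed_Fsigma/closedT.
rewrite (_ : [set _ | _] =
    [set y | forall i, (i < k)%N -> `[< F i y >] = nth false s i] `&`
    (if nth false s k then F k else ~` F k)).
  apply: FsigmaI => //; case: ifP => _; first exact: closed_Fsigma.
  exact/open_Fsigma/closed_openC.
apply/seteqP; split=> y /=.
  move=> sy; split; first by move=> i ik; apply: sy; rewrite ltnS ltnW.
  by move: (sy k (ltnSn k)); case: ifP => _ => [/asboolP|/asboolPn].
move=> [sy sk] i; rewrite ltnS leq_eqVlt => /orP[/eqP ->|]; last exact: sy.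
by move: sk; case: ifP => _ => [/asboolP|/asboolPn/negbTE].
Qed.

Lemma refined_network : separable X -> (forall n, closed (F n)) ->
  exists2 C : (set X)^nat,
    @network (refined F) C & forall n, @Fsigma X (C n).
Proof.
move=> /separable_network[B nB oB] cF.
exists (fun n => if unpickle n is Some (i, s) then B i `&` cell s else set0).
  move=> U x oU Ux.
  have /nbhs_mdistP[r r0 rU] : nbhs (x : refined F) U.
    exact: (@open_nbhs_nbhs (refined F)).
  (* Half of [r] goes to each summand of the refined metric. Points that agree on the first [N] sets
     can only differ from index [N] on, so their code distance is at most 1/(N+1). *)
  have r20 : 0 < r / 2 by rewrite divr_gt0.
  have [N] := ltr_add_invr r20; rewrite add0r => Nr.
  have [|i [Bx BU]] := nB [set y | mdist (x : X) y < r / 2] x (open_mdist_lt _ _).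
    by rewrite /= mdistxx.
  pose s := mkseq (fun j => `[< F j x >]) N.
  exists (pickle (i, s)); rewrite pickleK; split.
    by split=> // j; rewrite size_mkseq => jN; rewrite nth_mkseq.
  move=> y [/BU /= xy sy]; apply: rU; rewrite refined_mdistE [r]splitr ltrD//.
  case: (@code_distP R _ F x y) => [->//|[n + ->]].
  have [nN|Nn _] := ltnP n N.
    have := sy n; rewrite size_mkseq nth_mkseq// => /(_ nN) e.
    by rewrite /differ e eqxx.
  by rewrite (le_lt_trans _ Nr)// lef_pV2 ?posrE ?ltr0n// ler_nat ltnS.
move=> n; case: (unpickle n) => [[i s]|]; last exact/closed_Fsigma/closed0.
by apply: FsigmaI; [exact: open_Fsigma|exact: Fsigma_cell].
Qed.

End refined_metric.

(** * Diameters *)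

Section diameter.
Context {R : realType} {Y : metricType R}.
Implicit Types (S : set Y) (e : R).

Lemma mdist_lt_diam S e u v :
  (diam S < e%:E)%E -> S u -> S v -> mdist u v < e.
Proof.
move=> Se Su Sv; rewrite -lte_fin; apply: le_lt_trans Se.
by apply: ereal_sup_ubound; right; exists u => //; exists v.
Qed.

Lemma diam_le S e : 0 <= e ->
  (forall u v, S u -> S v -> mdist u v <= e) -> (diam S <= e%:E)%E.
Proof.
move=> e0 Se; apply: ge_ereal_sup => _ [->|[u Su [v Sv <-]]].
  by rewrite lee_fin.
by rewrite lee_fin; exact: Se.
Qed.

End diameter.

(** * Countable closed covers of small oscillation *)

Section decomposition.
Context {R : realType} {X Y : metricType R} (A : set (X -> Y)).
Implicit Types (e : R) (S : set X).

Definition osc_lt e S :=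
  forall f, A f -> forall x y, S x -> S y -> mdist (f x) (f y) < e.

(** The closed pieces cover [S] but may leave it, so the property passes to subsets; for [S = setT]
    it is condition (2) up to the choice of [e]. *)
Definition decomposable e S := exists G : (set X)^nat,
  [/\ forall n, closed (G n), S `<=` \bigcup_n G n & forall n, osc_lt e (G n)].

Lemma decomposable_Fsigma e S : Fsigma S -> osc_lt e S -> decomposable e S.
Proof.
move=> [G cG ->] oS; exists G; split=> // n f Af x y Gx Gy.
by apply: oS => //; exists n.
Qed.

Lemma sub_decomposable e S S' :
  S `<=` S' -> decomposable e S' -> decomposable e S.
Proof.
by move=> SS' [G [cG S'G oG]]; exists G; split=> //; exact: subset_trans S'G.
Qed.

Lemma decomposable_bigcup (C : countType) (D : set C) (F : C -> set X) e :
  (forall c, D c -> decomposable e (F c)) ->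
  decomposable e (\bigcup_(c in D) F c).
Proof.
move=> dF.
have /choice[G GP] : forall c, exists G : (set X)^nat,
    [/\ forall n, closed (G n), D c -> F c `<=` \bigcup_n G n &
        forall n, osc_lt e (G n)].
  move=> c; have [/dF[G [? ? ?]]|Dc] := pselect (D c); first by exists G.
  by exists (fun=> set0); split=> [_|/Dc|_ f _ x y []]//; exact: closed0.
pose L (p : C * nat) := G p.1 p.2.
exists (fun n => if unpickle n is Some p then L p else set0).
split=> [n|x [c Dc Fx]|n].
- case: (unpickle n) => [[c i]|]; last exact: closed0.
  by have [cG _ _] := GP c; exact: cG.
- rewrite bigcup_unpickle; have [_ FG _] := GP c.
  by have [i _ Gx] := FG Dc _ Fx; exists (c, i).
- case: (unpickle n) => [[c i]|]; last by move=> f _ x y [].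
  by have [_ _ oG] := GP c; exact: oG.
Qed.

Lemma equi_baire_decomposable e : separable X -> equi_baire_class_one A ->
  0 < e -> decomposable e setT.
Proof.
move=> /separable_network[B nB oB] EA e0; have [delta d1 dA] := EA e e0.
pose D n := [set x | n.+1%:R^-1 < set_val (delta x)].
have FD n : Fsigma (D n).
  apply: (d1 [set r | n.+1%:R^-1 < set_val r]).
  by exists [set r | n.+1%:R^-1 < r] => //; exact: open_gt.
(* Any two points of [D n] in such a basic set are closer than both values of [delta]. *)
pose small (p : nat * nat) :=
  forall y z, B p.2 y -> B p.2 z -> mdist y z < p.1.+1%:R^-1.
apply: (@sub_decomposable _ _ (\bigcup_(p in small) (D p.1 `&` B p.2))).
  move=> x _.
  have dx0 : 0 < set_val (delta x) by have := set_valP (delta x).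
  have [n] := ltr_add_invr dx0; rewrite add0r => nx.
  have n0 : 0 < n.+1%:R^-1 / 2 :> R by rewrite divr_gt0// invr_gt0 ltr0n.
  have [|i [Bx BU]] := nB _ x (open_mdist_lt x (n.+1%:R^-1 / 2)).
    by rewrite /= mdistxx.
  exists (n, i) => // y z /BU /= xy /BU /= xz.
  rewrite (le_lt_trans (metric_triangle y x z))// metric_sym.
  by rewrite [ltRHS]splitr ltrD.
apply: decomposable_bigcup => -[n i] /= sm; apply: decomposable_Fsigma.
  by apply: FsigmaI; [exact: FD|exact: open_Fsigma].
move=> f Af x y [Dx Bx] [Dy By]; apply: dA => //.
have xy := sm _ _ Bx By.
by rewrite lt_min (lt_trans xy Dx) (lt_trans xy Dy).
Qed.

Lemma continuity_decomposable e : separable X ->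
  (forall F : set X, closed F -> F !=set0 ->
     exists x : F, equicontinuous_at [set sigL F f | f in A] x) ->
  0 < e -> decomposable e setT.
Proof.
move=> /separable_network[B nB oB] cA e0.
(* Since the [B n] form a base, this is the largest decomposable open set. *)
pose O := \bigcup_(n in [set n | decomposable e (B n)]) B n.
have dO : decomposable e O by exact: decomposable_bigcup.
have cO : closed (~` O) by apply: open_closedC; apply: bigcup_open => n _.
have [[y Oy]|O0] := pselect (~` O !=set0); last first.
  apply: sub_decomposable dO => y _.
  by apply: contrapT => Oy; apply: O0; exists y.
have [x eqx] := cA _ cO (ex_intro _ y Oy).
have {eqx} := eqx (e / 2) (divr_gt0 e0 (ltr0Sn _ 1)).
rewrite /prop_near1 nbhsE => -[_ [[V oV <-] Vx] VA].
have [n [Bx BV]] := nB _ _ oV Vx.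
have Ox : ~ O (set_val x) := set_valP x.
exfalso; apply: Ox; exists n => //=.
(* It remains to decompose [B n], which would put the point [x] of the complement into [O]. The part
   in [O] is done; on the rest every value is within [e / 2] of the value at [x]. *)
apply: (@sub_decomposable _ _ (\bigcup_b if b then O else B n `\` O)).
  move=> z Bz; have [Oz|Oz] := pselect (O z); first by exists true.
  by exists false.
apply: decomposable_bigcup => -[] _ //; apply: decomposable_Fsigma.
  by apply: FsigmaI; [exact: open_Fsigma|exact: closed_Fsigma].
move=> f Af.
have near z : (B n `\` O) z -> mdist (f (set_val x)) (f z) < e / 2.
  move=> [Bz Oz].
  pose z' : ~` O := SigSub (mem_set (Oz : (~` O) z)).
  have /(_ (sigL (~` O) f)) : forall g, [set sigL (~` O) f | f in A] g ->
      mdist (g x) (g z') < e / 2 by apply: VA; exact: BV.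
  by apply; exists f.
move=> z z' /near xz /near xz'.
rewrite (le_lt_trans (metric_triangle _ (f (set_val x)) _))// metric_sym.
by rewrite [e]splitr ltrD.
Qed.

Let inv_pos_subproof (k : nat) : pos_reals R k.+1%:R^-1.
Proof. by rewrite /pos_reals /= invr_gt0 ltr0n. Qed.

Let inv_pos (k : nat) : pos_reals R := SigSub (mem_set (inv_pos_subproof k)).

Lemma decomposable_equi_baire :
  (forall e, 0 < e -> decomposable e setT) -> equi_baire_class_one A.
Proof.
move=> dA e /dA[G [cG GT oG]].
pose E m := \bigcup_(i < m) G i.
have cE m : closed (E m).
  by apply: closed_bigcup => [|i _]; [exact: finite_II|exact: cG].
(* Restricting delta to the values 1/(k+1) makes it factor through a map to nat
   with F_sigma fibres. *)
pose P (p : nat * nat) := G p.1 `&` far (E p.1) p.2.+1%:R^-1.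
pose Q n := if unpickle n is Some p then P p else set0.
have cQ n : closed (Q n).
  rewrite /Q; case: (unpickle n) => [p|]; last exact: closed0.
  by apply: closedI => //; exact: closed_far.
have least (S : set nat) n : S n -> exists2 m, S m & forall i, (i < m)%N -> ~ S i.
  move=> Sn; have ex : exists n, `[< S n >] by exists n; exact/asboolP.
  case: (ex_minnP ex) => m /asboolP Sm minm; exists m => // i im Si.
  by have := minm i (asboolT Si); rewrite leqNgt im.
(* If [m] is least with [x] in [G m], then [x] is outside the closed set [E m], hence at positive
   distance from it; so some [Q n] contains [x], and [c x] is the least such [n]. *)
have /choice[c cP] : forall x, exists n, Q n x /\ forall i, (i < n)%N -> ~ Q i x.
  move=> x; have [i _ Gx] := GT x I.
  have [m Gmx minm] := @least [set m | G m x] i Gx.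
  have [k _ fx] : (\bigcup_k far (E m) k.+1%:R^-1) x.
    by rewrite bigcup_far// => -[j /= jm]; exact: minm.
  have [|n Qn minn] := @least [set n | Q n x] (pickle (m, k)); last by exists n.
  by rewrite /= /Q pickleK.
(* The default 0 is never reached at [c x]: [Q n] is empty when [n] codes no pair. *)
pose rad n := inv_pos (if @unpickle (nat * nat)%type n is Some p then p.2 else 0%N).
exists (fun x => rad (c x)).
  move=> U _.
  (* The fibre of [c] over [n] is [Q n] minus the earlier [Q i], a difference of closed sets. *)
  rewrite (_ : _ @^-1` _ =
    \bigcup_(n in [set n | U (rad n)]) (Q n `\` \bigcup_(i < n) Q i)).
    apply: Fsigma_bigcup_cond => n _; apply: closedD_Fsigma => //.
    by apply: closed_bigcup => [|i _]; [exact: finite_II|exact: cQ].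
  apply/seteqP; split=> x /=.
    move=> Ux; exists (c x) => //; have [Qx minx] := cP x.
    by split=> // -[i /= ic]; exact: minx.
  move=> [n /= Un [Qn minn]]; have [Qx minx] := cP x.
  suff -> : c x = n by exact: Un.
  have [cn|nc|//] := ltngtP (c x) n; exfalso.
    by apply: minn; exists (c x).
  exact: minx nc Qn.
move=> x x'; rewrite lt_min => /andP[].
have [+ _] := cP x; have [+ _] := cP x'; rewrite /Q /rad.
case: (unpickle (c x')) => [[m' k']|//]; case: (unpickle (c x)) => [[m k]|//].
move=> [/= Gx' fx'] [/= Gx fx] xk xk' f Af.
(* If the first indices differ, the point with the smaller one lies in the union from which the
   other point is far, against the bound on their distance. *)
have [mm'|m'm|mm'] := ltngtP m m'.
- have : k'.+1%:R^-1 <= mdist x x' by apply: fx'; exists m.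
  by rewrite leNgt xk'.
- have : k.+1%:R^-1 <= mdist x' x by apply: fx; exists m'.
  by rewrite metric_sym leNgt xk.
- by rewrite -mm' in Gx'; exact: oG Af _ _ Gx Gx'.
Qed.

End decomposition.

(** * From covers to the fine topology, and from it to points of equicontinuity *)

Lemma cover_refinement (R : realType) (X Y : metricType R) (A : set (X -> Y)) :
  separable X ->
  (forall e : R, 0 < e -> exists G : (set X)^nat,
     [/\ forall m, closed (G m), \bigcup_m G m = setT &
         forall f, A f -> forall m, (diam (f @` G m) < e%:E)%E]) ->
  exists F : (set X)^nat,
    (forall n, closed (F n)) /\
    forall x : refined F, equicontinuous_at (A : set (refined F -> Y)) x.
Proof.
move=> sepX GA.
have /choice[G GP] : forall k, exists G : (set X)^nat,
     [/\ forall m, closed (G m), \bigcup_m G m = setT &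
         forall f, A f -> forall m, (diam (f @` G m) < (k.+1%:R^-1)%:E)%E].
  by move=> k; apply: GA; rewrite invr_gt0 ltr0n.
pose F n := if @unpickle (nat * nat)%type n is Some p then G p.1 p.2 else setT.
have cF n : closed (F n).
  rewrite /F; case: (unpickle n) => [p|]; last exact: closedT.
  by have [cG _ _] := GP p.1.
exists F; split=> //.
move=> x e e0; have [k] := ltr_add_invr e0; rewrite add0r => ke.
have [_ GT dG] := GP k.
have [m _ Gx] : (\bigcup_m G k m) x by rewrite GT.
have FE : F (pickle (k, m)) = G k m by rewrite /F pickleK.
have : nbhs x (F (pickle (k, m)) : set (refined F)).
  by apply: open_nbhs_nbhs; split; [exact: refined_open|rewrite FE].
apply: filterS => y; rewrite FE => Gy f Af; apply: lt_trans ke.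
by apply: mdist_lt_diam (dG _ Af m) _ _; [exists x|exists y].
Qed.

Lemma equicontinuity_point (R : realType) (X Y : metricType R)
    (A : set (X -> Y)) (tau : Topological X) (F : set X) :
  let Xtau : topologicalType := Topological.Pack tau in
  metrizable R Xtau -> separable Xtau ->
  (forall U : set X, @open Xtau U -> @Fsigma X U) ->
  (forall x : Xtau, equicontinuous_at (A : set (Xtau -> Y)) x) ->
  baire_space F -> F !=set0 ->
  exists x : F, equicontinuous_at [set sigL F f | f in A] x.
Proof.
move=> Xtau [m mE] sepXtau FXtau eqA baireF [x0 Fx0].
(* The countable base is built for the metric [m] and carried over to [tau] by the equality [mE] of
   their open sets. *)
have sepm : separable (Metric.Pack m).
  by move: sepXtau; rewrite /separable /dense mE.
have [B nB oB] := separable_network sepm.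
rewrite /network in nB; rewrite mE in nB oB.
have [|||x xB] := @baire_Fsigma_nbhs F (fun n => set_val @^-1` B n).
- exact: baireF.
- by exists (SigSub (mem_set Fx0)).
- move=> n; apply: (@Fsigma_preimage F X); first exact: initial_continuous.
  exact/FXtau/oB.
exists x => e e0; have := eqA (set_val x) e e0.
rewrite /prop_near1 nbhsE => -[V [oV Vx] VA].
have [n [Bx BV]] := nB V _ oV Vx.
apply: filterS (xB n Bx) => y By _ [f Af <-].
by apply: VA => //; exact: BV.
Qed.

(** * The cycle of implications *)

Theorem proposition32 (R : realType) (X Y : metricType R)
    (sepX : separable X)
    (baireX : forall F : set X, closed F -> baire_space F)
    (A : set (X -> Y)) :
  [<-> equi_baire_class_one A;
       forall e : R, 0 < e ->
         exists G : (set X)^nat,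
           [/\ forall m, closed (G m),
               \bigcup_m G m = [set: X] &
               forall f, A f -> forall m, (diam (f @` G m) < e%:E)%E];
       exists tau : Topological X,
         let Xtau : topologicalType := Topological.Pack tau in
         [/\ metrizable R Xtau,
             separable Xtau,
             forall U : set X, @open X U -> @open Xtau U,
             forall U : set X, @open Xtau U -> @Fsigma X U &
             forall x : Xtau, equicontinuous_at (A : set (Xtau -> Y)) x];
       forall F : set X, closed F -> F !=set0 ->
         exists x : F, equicontinuous_at [set sigL F f | f in A] x ].
Proof.
tfae.
(* A strict bound on distances gives only a weak bound on their supremum; starting from [e / 2]
   restores strictness. *)
- move=> EA e e0; have e20 : 0 < e / 2 by rewrite divr_gt0.
  have [G [cG GT oG]] := equi_baire_decomposable sepX EA e20.
  exists G; split=> //; first by apply/seteqP; split.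
  move=> f Af m; apply: (@le_lt_trans _ _ (e / 2)%:E).
    apply: diam_le; first exact: ltW.
    by move=> _ _ [x Gx <-] [y Gy <-]; apply/ltW; exact: oG Af _ _ Gx Gy.
  by rewrite lte_fin gtr_pMr// invf_lt1// ltr1n.
- move=> /(cover_refinement sepX)[F [cF eqA]].
  have [C nC FC] := refined_network sepX cF.
  exists (Topological.class (refined F)) => /=; split.
  + by exists (Metric.class (refined F)).
  + exact: network_separable nC.
  + exact: refined_finer.
  + move=> U /(network_bigcup nC) ->.
    by apply: Fsigma_bigcup_cond => n _; exact: FC.
  + exact: eqA.
- move=> [tau [mtau stau _ Ftau eqA]] F cF F0.
  exact (equicontinuity_point mtau stau Ftau eqA (baireX F cF) F0).
- move=> cA; apply: decomposable_equi_baire => e.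
  exact: continuity_decomposable.
Qed.
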